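(* There is a finite alphabet $\Sigma$ and a unary FO formula $\varphi(x\,;\,\bar y)$ over strings over $\Sigma$ such that there is no consistent formula learner for $\varphi$ (with local access to the string) whose running time is sublinear in the length of the string.
   Context: Strings as structures: a string $B=a_1\cdots a_n\in\Sigma^*$ is the finite structure with universe $U(B)=\{1,\ldots,n\}$ (its positions), the natural linear order $<$ on positions, and for each $a\in\Sigma$ a unary relation $R_a$ of the $a$-labelled positions (no successor relation in the signature). FO/MSO formulas are over the signature $\{<\}\cup\{R_a:a\in\Sigma\}$. A formula $\varphi(\bar x\,;\,\bar y)$ has instance variables $\bar x=(x_1,\ldots,x_k)$ ($k$ = arity; unary means $k=1$) and parameter variables $\bar y=(y_1,\ldots,y_\ell)$. For $\bar v\in U(B)^\ell$, $[\![\varphi(\bar x;\bar v)]\!]^B:U(B)^k\to\{0,1\}$ maps $\bar u$ to $1$ iff $B\models\varphi(\bar u;\bar v)$. A training set over $B$ is a finite $T\subseteq U(B)^k\times\{0,1\}$; $\bar v$ is consistent with $\varphi,B,T$ if $[\![\varphi(\bar x;\bar v)]\!]^B(\bar u)=\lambda$ for all $(\bar u,\lambda)\in T$; $T$ is $\varphi$-consistent if such $\bar v$ exists. Local access: a learner receives $T$ and initially holds only the positions occurring in $T$; it may query the label of a position it holds and retrieve the successor and predecessor of a position it holds; each operation costs one time step (uniform cost model). A consistent formula learner for $\varphi$ is a local-access algorithm for which there are numbers $q',\ell'$ such that on every string $B$ and every $\varphi$-consistent training set $T$ it outputs a formula $\varphi'(\bar x;\bar y')$ (of MSO, in particular possibly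 FO) of quantifier rank at most $q'$ with $|\bar y'|\le \ell'$, together with a tuple $\bar v'\in U(B)^{|\bar y'|}$ consistent with $\varphi',B,T$. Sublinear running time: for every fixed bound $t$ on the size of training sets there is a function $f_t$ with $f_t(n)/n\to 0$ such that the running time on every string of length $n$ and every training set of size at most $t$ is at most $f_t(n)$. *)

(* Defs.v *)
From mathcomp Require Import all_boot.
Set Implicit Arguments. Unset Strict Implicit. Unset Printing Implicit Defensive.

(* Strings as structures.  A string B : seq Sigma of length n has the
   universe {1,...,n}; position p (1 <= p <= n) carries label
   nth (p-1) of B.                                                      *)
Section Strings.
Variable Sigma : finType.

Definition in_univ (B : seq Sigma) (p : nat) : bool := (1 <= p) && (p <= size B).

Definition has_label (B : seq Sigma) (a : Sigma) (p : nat) : bool :=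
  onth B p.-1 == Some a.

(* MSO formulas over {<} u {R_a : a in Sigma} (with equality), with
   named first-order variables (nat) and named set variables (nat).    *)
Inductive form : Type :=
| FEq  (i j : nat)
| FLt  (i j : nat)
| FLab (a : Sigma) (i : nat)
| FMem (i X : nat)
| FNot (f : form)
| FAnd (f g : form)
| FOr  (f g : form)
| FEx  (i : nat) (f : form)
| FAll (i : nat) (f : form)
| FEx2 (X : nat) (f : form)
| FAll2 (X : nat) (f : form).

Fixpoint is_FO (f : form) : bool :=
  match f with
  | FEq _ _ | FLt _ _ | FLab _ _ => true
  | FMem _ _ => false
  | FNot g => is_FO g
  | FAnd g h | FOr g h => is_FO g && is_FO h
  | FEx _ g | FAll _ g => is_FO g
  | FEx2 _ _ | FAll2 _ _ => false
  end.

Fixpoint qrank (f : form) : nat :=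
  match f with
  | FEq _ _ | FLt _ _ | FLab _ _ | FMem _ _ => 0
  | FNot g => qrank g
  | FAnd g h | FOr g h => maxn (qrank g) (qrank h)
  | FEx _ g | FAll _ g | FEx2 _ g | FAll2 _ g => (qrank g).+1
  end.

Fixpoint fv1 (f : form) : seq nat :=
  match f with
  | FEq i j | FLt i j => [:: i; j]
  | FLab _ i => [:: i]
  | FMem i _ => [:: i]
  | FNot g => fv1 g
  | FAnd g h | FOr g h => fv1 g ++ fv1 h
  | FEx i g | FAll i g => filter (fun j => j != i) (fv1 g)
  | FEx2 _ g | FAll2 _ g => fv1 g
  end.

Fixpoint fv2 (f : form) : seq nat :=
  match f with
  | FEq _ _ | FLt _ _ | FLab _ _ => [::]
  | FMem _ X => [:: X]
  | FNot g => fv2 g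
  | FAnd g h | FOr g h => fv2 g ++ fv2 h
  | FEx _ g | FAll _ g => fv2 g
  | FEx2 X g | FAll2 X g => filter (fun Y => Y != X) (fv2 g)
  end.

(* phi(x ; y_1..y_l): instance variable x is variable 0, parameter y_j is
   variable j (1 <= j <= l); no other free variables, no free set vars. *)
Definition unary_formula (l : nat) (f : form) : bool :=
  all (fun i => i <= l) (fv1 f) && (fv2 f == [::]).

Definition upd {T : Type} (nu : nat -> T) (i : nat) (v : T) : nat -> T :=
  fun j => if j == i then v else nu j.

Fixpoint sat (B : seq Sigma) (nu1 : nat -> nat) (nu2 : nat -> nat -> bool)
    (f : form) : Prop :=
  match f with
  | FEq i j => nu1 i = nu1 j
  | FLt i j => nu1 i < nu1 j
  | FLab a i => has_label B a (nu1 i)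
  | FMem i X => nu2 X (nu1 i)
  | FNot g => ~ sat B nu1 nu2 g
  | FAnd g h => sat B nu1 nu2 g /\ sat B nu1 nu2 h
  | FOr g h => sat B nu1 nu2 g \/ sat B nu1 nu2 h
  | FEx i g => exists p, in_univ B p /\ sat B (upd nu1 i p) nu2 g
  | FAll i g => forall p, in_univ B p -> sat B (upd nu1 i p) nu2 g
  | FEx2 X g => exists S : nat -> bool,
      (forall p, S p -> in_univ B p) /\ sat B nu1 (upd nu2 X S) g
  | FAll2 X g => forall S : nat -> bool,
      (forall p, S p -> in_univ B p) -> sat B nu1 (upd nu2 X S) g
  end.

Definition env (u : nat) (v : seq nat) : nat -> nat :=
  fun i => if i == 0 then u else nth 0 v i.-1.

Definition holds (B : seq Sigma) (f : form) (u : nat) (v : seq nat) : Prop :=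
  sat B (env u v) (fun _ _ => false) f.

Definition training_set (B : seq Sigma) (T : seq (nat * bool)) : bool :=
  all (fun e => in_univ B e.1) T.

Definition consistent_param (f : form) (B : seq Sigma) (T : seq (nat * bool))
    (v : seq nat) : Prop :=
  all (in_univ B) v /\
  forall u lam, (u, lam) \in T -> (holds B f u v <-> lam = true).

Definition consistent_ts (l : nat) (f : form) (B : seq Sigma)
    (T : seq (nat * bool)) : Prop :=
  training_set B T /\ exists v, size v = l /\ consistent_param f B T v.

(* Local-access algorithms (deterministic).  The algorithm receives the
   training set T and sees the history of answers to its previous
   operations; at each step it either performs one operation on a
   position it holds, or halts with an output (formula, parameter tuple). *)
Inductive action : Type :=
| QLab  (p : nat)
| QSucc (p : nat)
| QPred (p : nat)
| Out   (f : form) (v : seq nat).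

Inductive response : Type :=
| RLab (a : Sigma)
| RNb  (b : bool).

Definition algorithm := seq (nat * bool) -> seq response -> action.

(* Run A on B, T with at most [fuel] operations (uniform cost: one time
   step per operation), from history h and held positions [held].
   Returns the output together with the finally held positions, or None
   if A did not halt within the budget or tried an illegal operation
   (an operation on a position it does not hold). *)
Fixpoint exec (A : algorithm) (B : seq Sigma) (T : seq (nat * bool))
    (fuel : nat) (h : seq response) (held : seq nat)
    : option (form * seq nat * seq nat) :=
  match A T h with
  | Out f v => Some (f, v, held)
  | QLab p =>
      match fuel with
      | 0 => None
      | fuel'.+1 =>
          if p \in held then
            match onth B p.-1 with
            | Some a => exec A B T fuel' (rcons h (RLab a)) held
            | None => None
            end
          else None
      end
  | QSucc p =>
      match fuel with
      | 0 => None
      | fuel'.+1 =>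
          if p \in held then
            if p < size B then exec A B T fuel' (rcons h (RNb true)) (rcons held p.+1)
            else exec A B T fuel' (rcons h (RNb false)) held
          else None
      end
  | QPred p =>
      match fuel with
      | 0 => None
      | fuel'.+1 =>
          if p \in held then
            if 1 < p then exec A B T fuel' (rcons h (RNb true)) (rcons held p.-1)
            else exec A B T fuel' (rcons h (RNb false)) held
          else None
      end
  end.

Definition run (A : algorithm) (B : seq Sigma) (T : seq (nat * bool)) (t : nat) :=
  exec A B T t [::] (map fst T).

Definition consistent_learner (l : nat) (phi : form) (A : algorithm) : Prop :=
  exists q' l' : nat,
    forall (B : seq Sigma) (T : seq (nat * bool)),
      consistent_ts l phi B T ->
      exists (t : nat) (phi' : form) (v' held : seq nat),
        run A B T t = Some (phi', v', held) /\
        qrank phi' <= q' /\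
        size v' <= l' /\
        unary_formula (size v') phi' /\
        all (fun p => p \in held) v' /\
        consistent_param phi' B T v'.

(* f(n)/n -> 0, stated over nat: for every e > 0, eventually e * f n <= n *)
Definition sublinear_fun (f : nat -> nat) : Prop :=
  forall e : nat, 0 < e -> exists N : nat, forall n : nat, N <= n -> e * f n <= n.

Definition sublinear_time (l : nat) (phi : form) (A : algorithm) : Prop :=
  forall t : nat, exists f : nat -> nat,
    sublinear_fun f /\
    forall (B : seq Sigma) (T : seq (nat * bool)),
      consistent_ts l phi B T -> size T <= t ->
      run A B T (f (size B)) <> None.

End Strings.

(* Main.v *)
Require Import Defs.
From mathcomp Require Import all_boot zify.
Set Implicit Arguments. Unset Strict Implicit. Unset Printing Implicit Defensive.

(**
The formula labels x by the bit written in the first nonblank letter after x.  Some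
letters write their bit in the clear; for the others the parameter y decides whether
the bit is to be negated.  In strings where nonblank letters are further from each
training example than the running time, the learner only sees blanks, so its output
(phi', v') does not depend on the nonblank letters.

A string consists of L+1 segments, L bounding the number of parameters of phi', of 3M
blocks each, a block having one nonblank letter in its middle.  Each segment contains
a positive example in front of block M and a negative one in front of block 2M.  Some
segment contains no parameter in v'.  In this one the letters write 0 except for one 1,
in block M for the string B1 and in block 2M for the string B2, all to be negated in
B2; in all other segments the correct labels are written in the clear.  If M is the
factorial of the number of MSO types of rank q, then repeating the 0-block M or 2M
times gives the same type, and so does repeating it M-1 or 2M-1 times.  Hence the positive
example of B1 and the negative example of B2 in this segment, both placed in front of
the unique 1, have the same type with respect to v', and phi' fails on one of them.
*)

(** * MSO types of words *)

Section Before.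
Variable X : Type.

(** This records order. Together with the set of occurring letters it is all that a quantifier-free
    formula sees of a word whose letters carry the variables. *)
Fixpoint before (P Q : pred X) (w : seq X) : bool :=
  if w is c :: w' then (P c && has Q w') || before P Q w' else false.

Lemma before_cat P Q u v :
  before P Q (u ++ v) = [|| before P Q u, before P Q v | has P u && has Q v].
Proof.
elim: u => [|c u IH] /=; first by rewrite orbF.
by rewrite IH has_cat; case: (P c); case: (has Q u); case: (has Q v);
  case: (before P Q u); case: (before P Q v); case: (has P u).
Qed.

Lemma beforeP P Q w :
  reflect (exists i j, [/\ i < j < size w, nth false (map P w) i & nth false (map Q w) j])
          (before P Q w).
Proof.
elim: w => [|c w IH] /=.
  by constructor => -[i [j [+ _ _]]]; rewrite ltn0 andbF.
apply: (iffP orP).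
  case=> [/andP[Pc]|/IH[i [j [ij Pi Qj]]]]; last by exists i.+1, j.+1; split.
  rewrite -(has_map Q id) => /(has_nthP false) [j jw Qj].
  by exists 0, j.+1; split => //=; rewrite size_map in jw.
case=> -[|i] [[|j]] [] //= ij Pi Qj.
  left; rewrite Pi /= -(has_map Q id).
  by apply/(has_nthP false); exists j => //; rewrite size_map; lia.
by right; apply/IH; exists i, j; split => //; lia.
Qed.
End Before.

Lemma before_map (X Y : Type) (f : X -> Y) P Q w :
  before P Q (map f w) = before (P \o f) (Q \o f) w.
Proof. by elim: w => //= c w ->; rewrite has_map. Qed.

(** This reduces arbitrary predicates to pairs of letters, of which a type of rank 0 can keep a
    finite list. *)
Lemma before_pred1 (X : eqType) (P Q : pred X) w :
  before P Q w <-> exists c d, [/\ P c, Q d & before (pred1 c) (pred1 d) w].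
Proof.
split.
  elim: w => //= c w IH /orP[/andP[Pc /hasP[d dw Qd]]|/IH[c' [d [Pc Qd b]]]].
    exists c, d; split => //; rewrite eqxx /=; apply/orP; left.
    by apply/hasP; exists d => //=.
  by exists c', d; split => //; rewrite b orbT.
move=> [c [d [Pc Qd]]]; elim: w => //= e w IH.
case/orP=> [/andP[/eqP-> /hasP[f fw /eqP ef]]|/IH->]; last by rewrite orbT.
by rewrite Pc /=; apply/orP; left; apply/hasP; exists f; rewrite // ef.
Qed.

Fixpoint Ty (q : nat) (X : finType) : finType :=
  if q is q'.+1 then {set Ty q' (X * bool)%type} else ({set X} * {set X * X})%type.

(* Marking a word with a set variable is [zip w m], so types of rank q.+1 over X
   are sets of types of rank q over X * bool.  First-order variables are treated
   as singleton marks; singletons are recognized already by types of rank 0. *)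
Fixpoint tp (q : nat) : forall X : finType, seq X -> Ty q X :=
  match q with
  | 0 => fun X w => ([set c in w], [set cd | before (pred1 cd.1) (pred1 cd.2) w])
  | q'.+1 => fun X w => [set tp q' (zip w m) | m : (size w).-tuple bool]
  end.

(** This is the set move of the Ehrenfeucht-Fraïssé game: [m'] is the answer to [m]. *)
Lemma tpS_eq q (X : finType) (w w' : seq X) (m : seq bool) :
  tp q.+1 w = tp q.+1 w' -> size m = size w ->
  exists2 m', size m' = size w' & tp q (zip w m) = tp q (zip w' m').
Proof.
move=> e sm; have: tp q (zip w m) \in tp q.+1 w.
  by move/eqP: sm => sm; apply/imsetP; exists (Tuple sm).
by rewrite e => /imsetP[m' _ ->]; exists m' => //; rewrite size_tuple.
Qed.

Lemma tp0P (X : finType) (w w' : seq X) :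
  tp 0 w = tp 0 w' <->
  (w =i w') /\ forall P Q, before P Q w = before P Q w'.
Proof.
split=> [[/setP e1 /setP e2]|[e1 e2]].
  split=> [c|P Q]; first by have := e1 c; rewrite !inE.
  by apply/idP/idP=> /before_pred1[c [d [Pc Qd]]] b; apply/before_pred1;
    exists c, d; split=> //; have := e2 (c, d); rewrite !inE /= b.
by congr (_, _); apply/setP=> c; rewrite !inE.
Qed.

Lemma tp0_map (X Y : finType) (f : X -> Y) (w w' : seq X) :
  tp 0 w = tp 0 w' -> tp 0 (map f w) = tp 0 (map f w').
Proof.
move=> /tp0P[e1 e2]; apply/tp0P; split; first exact: eq_mem_map.
by move=> P Q; rewrite !before_map.
Qed.

(** Mark [w] by the empty set, descend one rank, and forget the marks again. *)
Lemma tp_tp0 q (X : finType) (w w' : seq X) : tp q w = tp q w' -> tp 0 w = tp 0 w'.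
Proof.
elim: q X w w' => // q IH X w w' e.
have [m' sm' /IH/(tp0_map fst)] := tpS_eq e (size_nseq (size w) false).
by rewrite -!/(unzip1 _) !unzip1_zip ?size_nseq ?sm'.
Qed.

(** This is the composition property of types: a marking of a concatenation is cut at the seam, and
    the two pieces are answered separately. *)
Lemma tp_cat q (X : finType) (u u' v v' : seq X) :
  tp q u = tp q u' -> tp q v = tp q v' -> tp q (u ++ v) = tp q (u' ++ v').
Proof.
elim: q X u u' v v' => [|q IH] X u u' v v'.
  move=> /tp0P[e1 e2] /tp0P[e3 e4]; apply/tp0P; split.
    by move=> c; rewrite !mem_cat e1 e3.
  by move=> P Q; rewrite !before_cat e2 e4 (eq_has_r e1) (eq_has_r e3).
have sub (a a' b b' : seq X) : tp q.+1 a = tp q.+1 a' -> tp q.+1 b = tp q.+1 b' ->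
    tp q.+1 (a ++ b) \subset tp q.+1 (a' ++ b').
  move=> ea eb; apply/subsetP=> _ /imsetP[m _ ->].
  have sm : size m = size a + size b by rewrite size_tuple size_cat.
  have [|ma sa Ea] := tpS_eq (m := take (size a) m) ea; first by rewrite size_takel // sm leq_addr.
  have [|mb sb Eb] := tpS_eq (m := drop (size a) m) eb; first by rewrite size_drop sm addKn.
  have sm' : size (ma ++ mb) == size (a' ++ b') by rewrite !size_cat sa sb.
  apply/imsetP; exists (Tuple sm') => //=.
  rewrite -{1}(cat_take_drop (size a) m) !zip_cat ?sa // ?size_takel ?sm ?leq_addr //.
  exact: IH.
by move=> eu ev; apply/eqP; rewrite eqEsubset !sub.
Qed.

(** * Types determine the truth of formulas *)

Section Sat.
Variable Sigma : finType.

(* The letters of [w] carry the assignment to the free variables of [f]: [r1 i] and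
   [r2 Y] tell from a letter whether its position is [nu1 i], or belongs to [nu2 Y]. *)
Definition reads (X : finType) (w : seq X) (nu1 : nat -> nat) (nu2 : nat -> nat -> bool)
    (r1 r2 : nat -> pred X) (f : form Sigma) :=
  (forall i, i \in fv1 f ->
     0 < nu1 i <= size w /\ map (r1 i) w = mkseq (fun p => nu1 i == p.+1) (size w)) /\
  (forall Y, Y \in fv2 f -> map (r2 Y) w = mkseq (fun p => nu2 Y p.+1) (size w)).

Lemma reads_sub (X : finType) (w : seq X) nu1 nu2 r1 r2 (f g : form Sigma) :
  {subset fv1 g <= fv1 f} -> {subset fv2 g <= fv2 f} ->
  reads w nu1 nu2 r1 r2 f -> reads w nu1 nu2 r1 r2 g.
Proof. by move=> s1 s2 [h1 h2]; split=> [i /s1|Y /s2]; [exact: h1|exact: h2]. Qed.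

Lemma single_true (m : seq bool) :
  true \in m -> ~~ before id id m ->
  exists2 a, 0 < a <= size m & m = mkseq (fun p => a == p.+1) (size m).
Proof.
move=> tm nb; have im : index true m < size m by rewrite index_mem.
exists (index true m).+1; first by lia.
apply: (@eq_from_nth _ false); first by rewrite size_mkseq.
move=> p pm; rewrite nth_mkseq // eqSS.
have nt := nth_index false tm.
case: eqP => [<-//|ne]; apply/negP=> np; case/negP: nb; apply/beforeP.
rewrite map_id; case: (ltngtP p (index true m)) => c; last by case: ne.
  by exists p, (index true m); split; rewrite ?nt //; lia.
by exists (index true m), p; split; rewrite ?nt //; lia.
Qed.

(** This is the element move of the game. The singleton mark of [a] is answered by some set mark,
    and equality of the rank-0 types forces that mark to be a singleton too. *)
Lemma point_move q (X : finType) (w w' : seq X) a :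
  tp q.+1 w = tp q.+1 w' -> 0 < a <= size w ->
  exists a' (m m' : seq bool),
    [/\ 0 < a' <= size w',
        m = mkseq (fun p => a == p.+1) (size w),
        m' = mkseq (fun p => a' == p.+1) (size w') &
        tp q (zip w m) = tp q (zip w' m')].
Proof.
move=> e ha; set m := mkseq (fun p => a == p.+1) (size w).
have sm : size m = size w by rewrite size_mkseq.
have [m' sm' E] := tpS_eq e sm.
have /tp0P[e1 e2] : tp 0 m = tp 0 m'.
  have := tp0_map snd (tp_tp0 E).
  by rewrite -!/(unzip2 _) !unzip2_zip ?sm ?sm'.
have [||a' ha' em'] := @single_true m'.
- rewrite -e1; apply/(nthP false); exists a.-1; rewrite ?sm; first by lia.
  by rewrite nth_mkseq; [apply/eqP|]; lia.
- rewrite -e2; apply/negP=> /beforeP[i [j []]]; rewrite map_id sm => ij.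
  by rewrite !nth_mkseq; [move=> /eqP-> /eqP|..]; lia.
exists a', m, m'; split=> //; first by rewrite -sm'.
by rewrite -sm'.
Qed.

Lemma reads_nth (X : finType) (w : seq X) (r : pred X) a x p :
  map r w = mkseq (fun p => a == p.+1) (size w) -> p < size w ->
  r (nth x w p) = (a == p.+1).
Proof. by move=> e pw; rewrite -(nth_map x false) // e nth_mkseq. Qed.

(** Since [r] singles out one position, what holds there is told by the set of occurring letters,
    which is part of the rank-0 type. *)
Lemma reads_witness (X : finType) (w : seq X) (r : pred X) a (Q : pred X) :
  0 < a <= size w -> map r w = mkseq (fun p => a == p.+1) (size w) ->
  has (predI r Q) w = nth false (map Q w) a.-1.
Proof.
case: w => [|x w0]; first by rewrite /=; lia.
set w := x :: w0 => ha e.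
have aw : a.-1 < size w by lia.
rewrite (nth_map x) //; apply/(has_nthP x)/idP => [[p pw /andP[]]|Qa].
  by rewrite (reads_nth _ e) // => /eqP->.
by exists a.-1 => //; rewrite /= (reads_nth _ e) // Qa andbT; apply/eqP; lia.
Qed.

Lemma upd_same {T} (nu : nat -> T) i v : upd nu i v i = v.
Proof. by rewrite /upd eqxx. Qed.

Lemma upd_other {T} (nu : nat -> T) i j v : j != i -> upd nu i v j = nu j.
Proof. by rewrite /upd => /negbTE->. Qed.

Lemma reads_ext1 (X : finType) (w : seq X) nu1 nu2 r1 r2 i f g a :
  fv1 f = filter (fun j => j != i) (fv1 g) -> fv2 f = fv2 g ->
  reads w nu1 nu2 r1 r2 f -> 0 < a <= size w ->
  reads (zip w (mkseq (fun p => a == p.+1) (size w))) (upd nu1 i a) nu2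
    (upd (fun j (c : X * bool) => r1 j c.1) i snd) (fun Y c => r2 Y c.1) g.
Proof.
move=> e1 e2 [h1 h2] ha; set m := mkseq _ _.
have sm : size m = size w by rewrite size_mkseq.
have sz : size (zip w m) = size w by rewrite size1_zip ?sm.
have m1 (r : pred X) : map (fun c : X * bool => r c.1) (zip w m) = map r w.
  by rewrite (map_comp r fst) -/(unzip1 _) unzip1_zip ?sm.
split=> [j jg|Y Yg]; rewrite sz.
  case: (eqVneq j i) => [->|ji].
    by rewrite !upd_same; split=> //; rewrite -/(unzip2 _) unzip2_zip ?sm.
  by rewrite !upd_other // m1; apply: h1; rewrite e1 mem_filter ji.
by rewrite m1; apply: h2; rewrite e2.
Qed.

Lemma reads_ext2 (X : finType) (w : seq X) nu1 nu2 r1 r2 i f g (S : nat -> bool) m :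
  fv2 f = filter (fun j => j != i) (fv2 g) -> fv1 f = fv1 g ->
  reads w nu1 nu2 r1 r2 f -> m = mkseq (fun p => S p.+1) (size w) ->
  reads (zip w m) nu1 (upd nu2 i S)
    (fun j c => r1 j c.1) (upd (fun j (c : X * bool) => r2 j c.1) i snd) g.
Proof.
move=> e2 e1 [h1 h2] em.
have sm : size m = size w by rewrite em size_mkseq.
have sz : size (zip w m) = size w by rewrite size1_zip ?sm.
have m1 (r : pred X) : map (fun c : X * bool => r c.1) (zip w m) = map r w.
  by rewrite (map_comp r fst) -/(unzip1 _) unzip1_zip ?sm.
split=> [j jg|Y Yg]; rewrite sz; first by rewrite m1; apply: h1; rewrite e1.
case: (eqVneq Y i) => [->|ji].
  by rewrite !upd_same -/(unzip2 _) unzip2_zip ?sm.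
by rewrite !upd_other // m1; apply: h2; rewrite e2 mem_filter ji.
Qed.

Lemma lab_zip (X : finType) (lab : X -> Sigma) (w : seq X) (m : seq bool) :
  size m = size w -> map (fun c => lab c.1) (zip w m) = map lab w.
Proof. by move=> sm; rewrite (map_comp lab fst) -/(unzip1 _) unzip1_zip ?sm. Qed.

(** Induction on [f]. Each quantifier spends one rank and adds one bit to the letters, so the
    alphabet must vary. One implication suffices: the hypotheses are symmetric in the two words, and
    negation swaps them. *)
Lemma tp_sat (f : form Sigma) q (X : finType) (lab : X -> Sigma) (w w' : seq X)
    nu1 nu2 nu1' nu2' r1 r2 :
  qrank f <= q -> tp q w = tp q w' ->
  reads w nu1 nu2 r1 r2 f -> reads w' nu1' nu2' r1 r2 f ->
  sat (map lab w) nu1 nu2 f -> sat (map lab w') nu1' nu2' f.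
Proof.
elim: f q X lab w w' nu1 nu2 nu1' nu2' r1 r2 =>
  [i j|i j|a i|i Y|g IH|g IHg h IHh|g IHg h IHh|i g IH|i g IH|Y g IH|Y g IH]
  q X lab w w' nu1 nu2 nu1' nu2' r1 r2 /=.
- move=> _ /tp_tp0/tp0P[e _] [H _] [H' _].
  have [hi ri] := H i (mem_head _ _); have [hi' ri'] := H' i (mem_head _ _).
  have [|hj rj] := H j; first by rewrite !inE eqxx orbT.
  have [|hj' rj'] := H' j; first by rewrite !inE eqxx orbT.
  move=> eij; have := reads_witness (r1 j) hi ri.
  rewrite (eq_has_r e) (reads_witness (r1 j) hi' ri') rj rj' !nth_mkseq; lia.
- move=> _ /tp_tp0/tp0P[_ e] [H _] [H' _].
  have [hi ri] := H i (mem_head _ _); have [hi' ri'] := H' i (mem_head _ _).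
  have [|hj rj] := H j; first by rewrite !inE eqxx orbT.
  have [|hj' rj'] := H' j; first by rewrite !inE eqxx orbT.
  move=> lij; have: before (r1 i) (r1 j) w.
    by apply/beforeP; exists (nu1 i).-1, (nu1 j).-1; rewrite ri rj !nth_mkseq; try split; lia.
  rewrite e => /beforeP[x [y []]] xy; rewrite ri' rj' !nth_mkseq; lia.
- move=> _ /tp_tp0/tp0P[e _] [H _] [H' _].
  have [hi ri] := H i (mem_head _ _); have [hi' ri'] := H' i (mem_head _ _).
  rewrite /has_label.
  have aux (v : seq X) b : 0 < b <= size v ->
      (onth (map lab v) b.-1 == Some a) = nth false (map (fun c => lab c == a) v) b.-1.
    case: v => [|x v] hb; first by move: hb => /=; lia.
    by rewrite onthE -map_comp !(nth_map x) //; lia.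
  rewrite !aux // -(reads_witness _ hi ri) -(reads_witness _ hi' ri').
  by rewrite (eq_has_r e).
- move=> _ /tp_tp0/tp0P[e _] [H H2] [H' H2'].
  have [hi ri] := H i (mem_head _ _); have [hi' ri'] := H' i (mem_head _ _).
  have sY := H2 Y (mem_head _ _); have sY' := H2' Y (mem_head _ _).
  have := reads_witness (r2 Y) hi ri.
  rewrite (eq_has_r e) (reads_witness (r2 Y) hi' ri') sY sY' !nth_mkseq; try by lia.
  by rewrite !prednK; lia.
- by move=> qg e R R' ns s; apply: ns; apply: IH s; first exact: qg; eauto.
- rewrite geq_max => /andP[qg qh] e R R' [sg sh].
  have [sg1 sg2] := (mem_subseq (prefix_subseq (fv1 g) (fv1 h)),
                     mem_subseq (prefix_subseq (fv2 g) (fv2 h))).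
  have [sh1 sh2] := (mem_subseq (suffix_subseq (fv1 g) (fv1 h)),
                     mem_subseq (suffix_subseq (fv2 g) (fv2 h))).
  split.
    by apply: (IHg _ _ _ _ _ _ _ _ _ _ _ qg e _ _ sg); [apply: reads_sub R|apply: reads_sub R'].
  by apply: (IHh _ _ _ _ _ _ _ _ _ _ _ qh e _ _ sh); [apply: reads_sub R|apply: reads_sub R'].
- rewrite geq_max => /andP[qg qh] e R R'.
  have [sg1 sg2] := (mem_subseq (prefix_subseq (fv1 g) (fv1 h)),
                     mem_subseq (prefix_subseq (fv2 g) (fv2 h))).
  have [sh1 sh2] := (mem_subseq (suffix_subseq (fv1 g) (fv1 h)),
                     mem_subseq (suffix_subseq (fv2 g) (fv2 h))).
  case=> s; [left|right].
    by apply: (IHg _ _ _ _ _ _ _ _ _ _ _ qg e _ _ s); [apply: reads_sub R|apply: reads_sub R'].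
  by apply: (IHh _ _ _ _ _ _ _ _ _ _ _ qh e _ _ s); [apply: reads_sub R|apply: reads_sub R'].
- case: q => // q qg e R R' [p [pu s]].
  have [|p' [m [m' [hp' em em' E]]]] := point_move (a := p) e.
    by move: pu; rewrite /in_univ size_map.
  have hp : 0 < p <= size w by move: pu; rewrite /in_univ size_map.
  exists p'; split; first by rewrite /in_univ size_map.
  have sm : size m = size w by rewrite em size_mkseq.
  have sm' : size m' = size w' by rewrite em' size_mkseq.
  rewrite -(lab_zip lab sm') ; rewrite -(lab_zip lab sm) in s.
  apply: IH s; [exact: qg|exact: E| |].
    by rewrite em; apply: (reads_ext1 _ _ R).
  by rewrite em'; apply: (reads_ext1 _ _ R').
- case: q => // q qg e R R' s p' pu.
  have hp' : 0 < p' <= size w' by move: pu; rewrite /in_univ size_map.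
  (* For a universal quantifier the move is made in [w'] and answered in [w]. *)
  have [p [m' [m [hp em' em E]]]] := point_move (esym e) hp'.
  have sm : size m = size w by rewrite em size_mkseq.
  have sm' : size m' = size w' by rewrite em' size_mkseq.
  have pu' : in_univ (map lab w) p by rewrite /in_univ size_map.
  move: (s p pu'); rewrite -(lab_zip lab sm') -(lab_zip lab sm) => {}s.
  apply: IH s; [exact: qg|exact: esym E| |].
    by rewrite em; apply: (reads_ext1 _ _ R).
  by rewrite em'; apply: (reads_ext1 _ _ R').
- case: q => // q qg e R R' [S [Su s]].
  set m := mkseq (fun p => S p.+1) (size w).
  have sm : size m = size w by rewrite size_mkseq.
  have [m' sm' E] := tpS_eq e sm.
  (* Position [p] has index [p.-1] in the mark; the guard excludes 0, whose predecessor is again 0,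
     and the default [false] excludes positions past the end. *)
  exists (fun p => (0 < p) && nth false m' p.-1); split.
    case=> // p /= h; rewrite /in_univ size_map -sm' /=.
    by rewrite ltnNge; apply/negP=> le; rewrite nth_default in h.
  rewrite -(lab_zip lab sm') ; rewrite -(lab_zip lab sm) in s.
  apply: IH s; [exact: qg|exact: E| |].
    by apply: (reads_ext2 _ _ R).
  apply: (reads_ext2 _ _ R') => //=.
  rewrite -sm'; apply: (@eq_from_nth _ false); rewrite ?size_mkseq // => p pm.
  by rewrite nth_mkseq.
- case: q => // q qg e R R' s S Su.
  set m' := mkseq (fun p => S p.+1) (size w').
  have sm' : size m' = size w' by rewrite size_mkseq.
  have [m sm E] := tpS_eq (esym e) sm'.
  have Su' p : (0 < p) && nth false m p.-1 -> in_univ (map lab w) p.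
    case: p => // p /= h; rewrite /in_univ size_map -sm /=.
    by rewrite ltnNge; apply/negP=> le; rewrite nth_default in h.
  move: (s _ Su'); rewrite -(lab_zip lab sm') -(lab_zip lab sm) => {}s.
  apply: IH s; [exact: qg|exact: esym E| |].
    apply: (reads_ext2 _ _ R) => //=.
    rewrite -sm; apply: (@eq_from_nth _ false); rewrite ?size_mkseq // => p pm.
    by rewrite nth_mkseq.
  exact: (reads_ext2 _ _ R').
Qed.
End Sat.

(** * Powers of a word and the periodicity of their types *)

Definition pow {T : Type} (b : seq T) (n : nat) : seq T := flatten (nseq n b).

Lemma powD (T : Type) (b : seq T) m n : pow b (m + n) = pow b m ++ pow b n.
Proof. by rewrite /pow nseqD flatten_cat. Qed.

(** With K types, two of the powers 0 to K agree, say [i < j]. From exponent [i] on, types then have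
    period [j - i], which is at most K and so divides K!. *)
Lemma tp_pow q (X : finType) (b : seq X) n :
  let M := #|Ty q X|`! in
  M.-1 <= n -> tp q (pow b n) = tp q (pow b (n + M)).
Proof.
move=> M hn; pose g (i : 'I_#|Ty q X|.+1) := tp q (pow b i).
have /injectivePn[i [j ij gij]] : ~~ injectiveb g.
  by apply/negP=> /injectiveP/leq_card; rewrite card_ord ltnn.
wlog lij: i j ij gij / i < j.
  move=> W; have : (i : nat) != j by [].
  by rewrite neq_ltn => /orP[l|l]; [apply: (W i j)|apply: (W j i); rewrite // eq_sym].
have period e : i <= e -> tp q (pow b e) = tp q (pow b (e + (j - i))).
  move=> ie; rewrite -{1}(subnKC ie) powD.
  have -> : e + (j - i) = j + (e - i) by lia.
  by rewrite powD; apply: tp_cat.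
have jK : j <= #|Ty q X| by rewrite -ltnS ltn_ord.
have iM : i <= M.-1 by have := fact_geq #|Ty q X|; rewrite -/M; lia.
have /dvdnP[s ->] : j - i %| M by apply: dvdn_fact; lia.
elim: s => [|s IH]; first by rewrite addn0.
rewrite IH mulSn [j - i + _]addnC addnA; apply: period; lia.
Qed.

Lemma nth_flatten_uniform (T : Type) (x : T) (ss : seq (seq T)) w i j :
  all (fun s => size s == w) ss -> i < size ss -> j < w ->
  nth x (flatten ss) (i * w + j) = nth x (nth [::] ss i) j.
Proof.
elim: ss i => //= s ss IH [|i] /andP[/eqP sw sss] iss jw; rewrite nth_cat sw.
  by rewrite mul0n add0n jw.
rewrite mulSn -addnA ltnNge leq_addr /= addKn; exact: IH.
Qed.

Lemma size_flatten_uniform (T : Type) (ss : seq (seq T)) w :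
  all (fun s => size s == w) ss -> size (flatten ss) = size ss * w.
Proof. by elim: ss => //= s ss IH /andP[/eqP sw /IH]; rewrite size_cat sw mulSn => ->. Qed.

(** * Locality of runs *)

Section Exec.
Variables (Sigma : finType) (A : algorithm Sigma).
Implicit Types (B : seq Sigma) (T : seq (nat * bool)).

Lemma exec_mono B T fuel fuel' h held r :
  exec A B T fuel h held = Some r -> fuel <= fuel' -> exec A B T fuel' h held = Some r.
Proof.
elim: fuel fuel' h held => [|fuel IH] [|fuel'] h held //=;
  case: (A T h) => // p; case: ifP => // _.
- by case: (onth B p.-1) => // a e l; apply: IH.
- by case: ifP => _ e l; apply: IH.
- by case: ifP => _ e l; apply: IH.
Qed.

Lemma run_eq B T t t' r : run A B T t = Some r -> run A B T t' <> None -> run A B T t' = Some r.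
Proof.
rewrite /run => e; case e': exec => [r'|] // _.
by case: (leqP t t') => l; [rewrite -e' (exec_mono e l)|rewrite -e (exec_mono e' (ltnW l))].
Qed.

Definition near (us : seq nat) (d p : nat) : Prop :=
  exists2 u, u \in us & (p <= u + d) && (u <= p + d).

(** An operation consumes one unit of fuel and moves held positions at most one step further away,
    so [d + fuel] never grows. Equal lengths make the tests for the right end agree. *)
Lemma exec_local B B' T (us : seq nat) d fuel h held :
  size B = size B' -> (forall p, near us (d + fuel) p -> onth B p.-1 = onth B' p.-1) ->
  (forall p, p \in held -> near us d p) ->
  exec A B T fuel h held = exec A B' T fuel h held.
Proof.
move=> sB; elim: fuel d h held => [|fuel IH] d h held eB nh /=;
  case: (A T h) => // p; case: ifP => // pheld; have [u uT pu] := nh p pheld.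
- have -> : onth B p.-1 = onth B' p.-1 by apply: eB; exists u => //; lia.
  case: (onth B' p.-1) => // a; apply: (IH d) => // p' [u' u'T ?].
  by apply: eB; exists u' => //; lia.
- rewrite -sB; case: ifP => _; last first.
    by apply: (IH d) => // p' [u' u'T ?]; apply: eB; exists u' => //; lia.
  apply: (IH d.+1) => [p' [u' u'T ?]|p']; first by apply: eB; exists u' => //; lia.
  rewrite mem_rcons inE => /orP[/eqP->|/nh[u' u'T ?]]; [exists u|exists u'] => //; lia.
- case: ifP => _; last first.
    by apply: (IH d) => // p' [u' u'T ?]; apply: eB; exists u' => //; lia.
  apply: (IH d.+1) => [p' [u' u'T ?]|p']; first by apply: eB; exists u' => //; lia.
  rewrite mem_rcons inE => /orP[/eqP->|/nh[u' u'T ?]]; [exists u|exists u'] => //; lia.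
Qed.

Lemma run_local B B' T t :
  size B = size B' -> (forall p, near (map fst T) t p -> onth B p.-1 = onth B' p.-1) ->
  run A B T t = run A B' T t.
Proof.
move=> sB eB; apply: (@exec_local _ _ _ (map fst T) 0) => // p pT.
by exists p => //; lia.
Qed.
End Exec.

(** * Words marked with parameters *)

Section Mark.
Variables (Sigma : finType) (L : nat).
Local Notation X := (Sigma * {set 'I_L.+1})%type.

(** Each letter carries the set of variables placed on it; the indices are the instance variable 0
    and up to [L] parameters. The offset [o] lets factors of a string be marked separately. The
    value 0, which [env] gives to absent parameters, marks nothing. *)
Fixpoint mark (nu : nat -> nat) (o : nat) (B : seq Sigma) : seq X :=
  if B is c :: B' then (c, [set i : 'I_L.+1 | nu i == o.+1]) :: mark nu o.+1 B' else [::].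

Lemma size_mark nu o B : size (mark nu o B) = size B.
Proof. by elim: B o => //= c B IH o; rewrite IH. Qed.

Lemma mark_cat nu o u v : mark nu o (u ++ v) = mark nu o u ++ mark nu (o + size u) v.
Proof. by elim: u o => [|c u IH] o /=; rewrite ?addn0 // IH addnS. Qed.

Lemma mark_fst nu o B : map fst (mark nu o B) = B.
Proof. by elim: B o => //= c B IH o; rewrite IH. Qed.

Lemma mark_ext (nu nu' : nat -> nat) o B :
  (forall (i : 'I_L.+1) p, o < p <= o + size B -> (nu i == p) = (nu' i == p)) ->
  mark nu o B = mark nu' o B.
Proof.
elim: B o => //= c B IH o e; congr ((_, _) :: _).
  by apply/setP=> i; rewrite !inE e //; lia.
by apply: IH => i p h; apply: e; lia.
Qed.

Lemma mark_none (nu : nat -> nat) o B :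
  (forall (i : 'I_L.+1), ~~ (o < nu i <= o + size B)) ->
  mark nu o B = map (fun c => (c, set0)) B.
Proof.
elim: B o => //= c B IH o e; congr ((_, _) :: _).
  by apply/setP=> i; rewrite !inE; apply/negP=> /eqP h; have := e i; rewrite h; lia.
by apply: IH => i; have := e i; lia.
Qed.

Lemma mark_map (nu : nat -> nat) o B (i : 'I_L.+1) :
  map (fun c : X => i \in c.2) (mark nu o B) = mkseq (fun p => nu i == (o + p).+1) (size B).
Proof.
elim: B o => //= c B IH o; rewrite /mkseq /= IH inE addn0; congr (_ :: _).
rewrite /mkseq (iotaDl 1 0) -map_comp; apply: eq_map => p /=.
by rewrite add1n addnS addSn.
Qed.

Lemma tp_holds q (B B' : seq Sigma) (f : form Sigma) u u' v :
  size B = size B' -> qrank f <= q -> size v <= L -> unary_formula (size v) f ->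
  in_univ B u -> in_univ B u' -> all (in_univ B) v ->
  tp q (mark (env u v) 0 B) = tp q (mark (env u' v) 0 B') ->
  holds B f u v -> holds B' f u' v.
Proof.
move=> sB qf vL /andP[/allP f1 /eqP f2] hu hu' /allP hv e; rewrite /holds.
have R D x : size D = size B -> in_univ B x ->
    reads (mark (env x v) 0 D) (env x v) (fun _ _ => false)
      (fun i (c : X) => (inord i : 'I_L.+1) \in c.2) (fun _ _ => false) f.
  move=> sD hx; split=> [i /f1/= iv|Y]; last by rewrite f2.
  rewrite size_mark sD; split.
    rewrite /env; case: eqP => [_|i0]; first exact: hx.
    by apply: hv; apply: mem_nth; case: i iv i0.
  by rewrite mark_map sD inordK // ltnS (leq_trans iv).
rewrite -(mark_fst (env u v) 0 B) -(mark_fst (env u' v) 0 B').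
by apply: tp_sat qf e _ _; apply: R.
Qed.
End Mark.

(** * The hard instances *)

(* [None] is blank; [Some (true, b)] stands for the bit b, and [Some (false, b)] for b
   or its negation, according to whether the parameter is blank or not. *)
Definition letter : finType := option (bool * bool).

(* The bit of the first nonblank letter after variable 0, with parameter variable 1. *)
Definition next_bit : form letter :=
  FEx 2 (FAnd (FLt _ 0 2) (FAnd (FNot (FLab None 2)) (FAnd
    (FAll 3 (FOr (FNot (FAnd (FLt _ 0 3) (FLt _ 3 2))) (FLab None 3)))
    (FOr (FLab (Some (true, true)) 2)
    (FOr (FAnd (FLab (Some (false, true)) 2) (FLab None 1))
         (FAnd (FLab (Some (false, false)) 2) (FNot (FLab None 1)))))))).

Lemma holds_next_bit (B : seq letter) x y z s b :
  x < z -> onth B z.-1 = Some (Some (s, b)) ->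
  (forall w, x < w < z -> onth B w.-1 = Some None) ->
  holds B next_bit x [:: y] <-> (if s then b else b == has_label B None y).
Proof.
move=> xz Bz blank; rewrite /holds /=; split.
  case=> z' [/andP[z'0 z'n]]; rewrite /env /upd /= => -[xz' [nz' [bl]]].
  (* A later witness would have the nonblank [z] between [x] and itself, and an earlier one would be
     blank. *)
  have -> : z' = z.
    case: (ltngtP z z') => // c.
      have zu : in_univ B z by rewrite /in_univ; lia.
      by case: (bl z zu) => [[]//|]; rewrite /has_label Bz.
    by case: nz'; rewrite /has_label blank // xz'.
  rewrite /has_label Bz; case: s b {Bz} => [] [] //=.
  - by case=> [//|[[//]|[//]]].
  - by case=> [//|[[_ ->]//|[//]]].
  - by case=> [//|[[//]|[_ /negP/negbTE->]]].
move=> h; exists z; rewrite /env /upd /=; split.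
  by rewrite /in_univ; have := onthTE B z.-1; rewrite Bz /=; lia.
split=> //; split; first by rewrite /has_label Bz.
split.
  move=> w _; case: (boolP (x < w < z)) => [/blank e|/negP n]; [right|left].
    by rewrite /has_label e.
  by move=> -[a c]; apply: n; rewrite a.
rewrite {1 2 4}/has_label Bz; case: s b h {Bz} => [] [] //=; try by left.
  by move=> /eqP e; right; left; split=> //; rewrite -e.
by move=> /eqP e; right; right; split=> //; rewrite -e.
Qed.

(** * Strings of blocks padded with blanks *)

Section Strings.
Variable k : nat.
Local Notation D := (k.*2.+1).

Definition block (c : letter) : seq letter := nseq k None ++ c :: nseq k None.
Definition str (s : seq letter) : seq letter := flatten (map block s).
(** Positions count from 1, so this is where block [r] starts, [k] steps before its nonblank
    letter. *)
Definition pos (r : nat) : nat := (r * D).+1.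

Lemma size_block c : size (block c) = D.
Proof. by rewrite size_cat /= !size_nseq; lia. Qed.

Lemma block_uniform s : all (fun b => size b == D) (map block s).
Proof. by apply/allP=> _ /mapP[c _ ->]; rewrite size_block. Qed.

Lemma size_str s : size (str s) = size s * D.
Proof. by rewrite (size_flatten_uniform (block_uniform s)) size_map. Qed.

Lemma str_cat s t : str (s ++ t) = str s ++ str t.
Proof. by rewrite /str map_cat flatten_cat. Qed.

Lemma str_nseq n c : str (nseq n c) = pow (block c) n.
Proof. by rewrite /str map_nseq. Qed.

Lemma onth_str s r j : r < size s -> j < D ->
  onth (str s) (r * D + j) = Some (if j == k then nth None s r else None).
Proof.
move=> rs jD; have lt : r * D + j < size (str s) by rewrite size_str; nia.
rewrite onthE (nth_map None) //; congr Some.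
rewrite (nth_flatten_uniform _ (block_uniform s)) ?size_map //.
rewrite (nth_map None) // nth_cat size_nseq; case: ltnP => jk.
  by rewrite nth_nseq jk; case: eqP => //; lia.
case: eqP => [->|ne]; first by rewrite subnn.
have -> : j - k = (j - k).-1.+1 by lia.
by rewrite /= nth_nseq; case: ifP.
Qed.

Lemma holds_pos s r y sg b : r < size s -> nth None s r = Some (sg, b) -> 0 < k ->
  holds (str s) next_bit (pos r) [:: y] <-> (if sg then b else b == has_label (str s) None y).
Proof.
move=> rs e k0; apply: (@holds_next_bit _ _ _ (r * D + k).+1).
- by rewrite /pos; lia.
- by rewrite /= onth_str ?eqxx ?e //; lia.
move=> w hw; have -> : w.-1 = r * D + (w.-1 - r * D) by rewrite /pos in hw; lia.
by rewrite /pos in hw; rewrite onth_str //; [case: eqP => //; lia|lia].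
Qed.

(** A block start is [k] steps from the middle of its own block and at least [k.+1] from the middle
    of any earlier block, so within distance [d] both strings are blank or have ended. *)
Lemma near_blank s s' us d p : size s = size s' -> d < k ->
  (forall u, u \in us -> exists r, u = pos r) -> near us d p ->
  onth (str s) p.-1 = onth (str s') p.-1.
Proof.
move=> es dk hus [u /hus[r ->] hp]; rewrite /pos in hp.
have pd := divn_eq p.-1 D; have jD : p.-1 %% D < D by rewrite ltn_pmod.
case: (ltnP (p.-1 %/ D) (size s)) => c; last first.
  by rewrite !onth_default // size_str -?es (leq_trans (leq_mul c (leqnn D))) // {2}pd leq_addr.
suff jk : p.-1 %% D != k by rewrite {1 2}pd !onth_str -?es // (negbTE jk).
apply/eqP=> jk; rewrite jk in pd.
case: (ltnP (p.-1 %/ D) r) => ar.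
  by have := leq_mul ar (leqnn D); rewrite mulSn; lia.
by have := leq_mul ar (leqnn D); lia.
Qed.
End Strings.

(** * The strings with a hidden segment and their training set *)

Section Construction.
Variables L M k : nat.
Local Notation D := (k.*2.+1).

Definition seg (b : bool) (m : nat) : seq letter := mkseq (fun j => Some (b, j == m)) (3 * M).

Definition segs (hid m i : nat) := if i == hid then seg false m else seg true M.

(* With [hid > L] no segment depends on the parameter. *)
Definition letters (hid m : nat) : seq letter :=
  flatten (map (segs hid m) (iota 0 L.+1)).

Definition example_block (i : nat) (c : bool) : nat := i * (3 * M) + (if c then M else 2 * M).

Definition examples : seq (nat * bool) :=
  [seq (pos k (example_block i c), c) | i <- iota 0 L.+1, c <- [:: true; false]].

Lemma examplesP u c :
  reflect (exists2 i, i <= L & u = pos k (example_block i c)) ((u, c) \in examples).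
Proof.
apply: (iffP allpairsP) => [[[i d] [iL _ [-> ->]]]|[i iL ->]].
  by exists i => //; move: iL; rewrite mem_iota.
by exists (i, c); split; rewrite ?mem_iota //; case: c.
Qed.

Lemma size_examples : size examples = 2 * L.+1.
Proof. by rewrite size_allpairs size_iota mulnC. Qed.

Lemma seg_uniform hid m r : all (fun s => size s == 3 * M) (map (segs hid m) r).
Proof. by apply/allP=> _ /mapP[i _ ->]; rewrite /segs; case: ifP; rewrite size_mkseq. Qed.

Lemma size_letters hid m : size (letters hid m) = L.+1 * (3 * M).
Proof. by rewrite (size_flatten_uniform (seg_uniform _ _ _)) size_map size_iota. Qed.

Lemma nth_letters hid m i j : i <= L -> j < 3 * M ->
  nth None (letters hid m) (i * (3 * M) + j) =
  Some (i != hid, j == if i == hid then m else M).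
Proof.
move=> iL j3; rewrite (nth_flatten_uniform _ (seg_uniform _ _ _)) ?size_map ?size_iota //.
rewrite (nth_map 0) ?size_iota // nth_iota // add0n /segs.
by case: eqP => _; rewrite nth_mkseq.
Qed.

Lemma example_block_lt hid m i c : 0 < M -> i <= L -> example_block i c < size (letters hid m).
Proof. by move=> M0 iL; rewrite size_letters /example_block; case: c; nia. Qed.

Lemma consistent_examples hid m : 0 < M -> 0 < k -> m = M \/ m = 2 * M ->
  consistent_ts 1 next_bit (str k (letters hid m)) examples.
Proof.
move=> M0 k0 hm; split.
  apply/allP=> -[u c] /examplesP[i iL ->]; rewrite /in_univ /= size_str /pos.
  by have := leq_mul (example_block_lt hid m c M0 iL) (leqnn D); rewrite mulSn; lia.
(* Position 1 is blank, so the hidden bits are read as written; position [k.+1] holds the first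
   nonblank letter, so they are negated. *)
pose y := if m == M then 1 else k.+1.
have s0 : 0 < size (letters hid m) by rewrite size_letters; nia.
have n0 : D <= size (str k (letters hid m)) by rewrite size_str leq_pmull.
have by0 : has_label (str k (letters hid m)) None y = (m == M).
  have e j : j < D -> onth (str k (letters hid m)) j = _ := @onth_str k _ 0 j s0.
  rewrite /has_label /y; case: (m =P M) => _.
    by rewrite -[1.-1]/0 (e 0) // (ltn_eqF k0).
  rewrite -[k.+1.-1]/k (e k) ?eqxx; last by lia.
  have M3 : 0 < 3 * M by lia.
  by rewrite (nth_letters hid m (leq0n L) M3 : nth _ _ 0 = _).
exists [:: y]; split=> //; split.
  by rewrite /= /y /in_univ; case: eqP => _; lia.
move=> u c /examplesP[i iL ->].
rewrite (holds_pos _ (example_block_lt hid m c M0 iL) (nth_letters _ _ iL _)) //;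
  last by case: (c); lia.
rewrite by0; case: eqP => [_|_] /=; last by case: c => /=; lia.
by case: hm => ->; case: c => /=; lia.
Qed.

Lemma seg_split b m : m < 3 * M ->
  seg b m = nseq m (Some (b, false)) ++ Some (b, true) :: nseq (3 * M - m.+1) (Some (b, false)).
Proof.
move=> m3; apply: (@eq_from_nth _ None); rewrite size_mkseq.
  by rewrite size_cat /= !size_nseq; lia.
move=> j j3; rewrite nth_mkseq // nth_cat size_nseq.
case: ltngtP => [c|c|->]; [by rewrite nth_nseq c| |by rewrite subnn].
have -> : j - m = (j - m).-1.+1 by lia.
by rewrite /= nth_nseq; case: ifP => //; lia.
Qed.

Lemma letters_split hid : hid <= L ->
  exists pre post, size pre = hid * (3 * M) /\
    forall m, letters hid m = pre ++ seg false m ++ post.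
Proof.
move=> kL; exists (flatten (map (fun=> seg true M) (iota 0 hid))).
exists (flatten (map (fun=> seg true M) (iota hid.+1 (L - hid)))); split.
  rewrite (@size_flatten_uniform _ _ (3 * M)) ?size_map ?size_iota //.
  by apply/allP=> _ /mapP[i _ ->]; rewrite size_mkseq.
move=> m; rewrite /letters.
have -> : L.+1 = hid + (L - hid).+1 by lia.
rewrite iotaD map_cat flatten_cat /= {2}/segs add0n eqxx.
by congr (flatten _ ++ _ ++ flatten _); apply/eq_in_map=> i; rewrite mem_iota /segs;
  case: eqP => // ->; lia.
Qed.

Local Notation X := (letter * {set 'I_L.+1})%type.

Definition zero_block : seq X := map (fun c => (c, set0)) (block k (Some (false, false))).

(** This is the block of the hidden 1 with the instance variable on its first letter, which is blank
    if [0 < k]. *)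
Definition marked_one_block : seq X :=
  (None, [set ord0]) :: map (fun c => (c, set0)) (behead (block k (Some (false, true)))).

(** The instance variable stands in front of the 1 and no parameter lies in the segment, so [m]
    enters only through the two exponents. *)
Lemma mark_seg (nu : nat -> nat) o m : 0 < k -> m < 3 * M ->
  nu 0 = (o + m * D).+1 ->
  (forall i : 'I_L.+1, i != ord0 -> ~~ (o < nu i <= o + 3 * M * D)) ->
  mark L nu o (str k (seg false m)) =
  pow zero_block m ++ marked_one_block ++ pow zero_block (3 * M - m.+1).
Proof.
move=> k0 m3 nu0 nus.
have pow_zero n :
    pow zero_block n = map (fun c => (c, set0)) (str k (nseq n (Some (false, false)))).
  by rewrite str_nseq /pow map_flatten map_nseq.
have powD : m * D + D + (3 * M - m.+1) * D = 3 * M * D.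
  by rewrite -mulSnr -mulnDl subnKC.
(* A stretch of the segment that misses the instance variable contains no variable. *)
have far o' n : (o <= o') -> o' + n <= o + 3 * M * D ->
    ~~ (o' < nu 0 <= o' + n) -> forall i : 'I_L.+1, ~~ (o' < nu i <= o' + n).
  move=> h1 h2 h3 i; case: (eqVneq i ord0) => [->//|/nus]; lia.
have eb : str k [:: Some (false, true)] = None :: behead (block k (Some (false, true))).
  by rewrite /str /= cats0 /block -(prednK k0).
have sb : size (behead (block k (Some (false, true)))) = k.*2.
  by rewrite size_behead size_block.
rewrite /marked_one_block; move: (behead _) eb sb => rest eb sb.
rewrite seg_split // -cat1s !str_cat eb -[None :: rest]cat1s !mark_cat.
rewrite !size_str !size_nseq -(cat1s (None, [set ord0])) !pow_zero -!catA; congr (_ ++ _ ++ _ ++ _).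
- by apply: mark_none; rewrite size_str size_nseq; apply: far; lia.
- congr [:: (_, _)].
    apply/setP=> i; rewrite !inE; case: (eqVneq i ord0) => [->|/nus h].
    by rewrite nu0 eqxx.
  by apply/negP=> /eqP e; move: h; rewrite e; lia.
- by apply: mark_none; rewrite sb; apply: far => /=; lia.
- by apply: mark_none; rewrite size_str size_nseq size_cat sb; apply: far => /=; lia.
Qed.
End Construction.

(** The strings and their marks agree outside the hidden segment. Inside, the exponents are [M] and
    [2 * M] before the 1, and [2 * M - 1] and [M - 1] after it; [tp_pow] identifies each pair. *)
Lemma tp_letters_shift q L k hid u u' v :
  let M := #|Ty q (letter * {set 'I_L.+1})%type|`! in
  let o := hid * (3 * M) * k.*2.+1 in
  let B m := str k (letters L M hid m) in
  0 < k -> hid <= L ->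
  u = pos k (example_block M hid true) -> u' = pos k (example_block M hid false) ->
  (forall i, ~~ (o < nth 0 v i <= o + 3 * M * k.*2.+1)) ->
  tp q (mark L (env u v) 0 (B M)) = tp q (mark L (env u' v) 0 (B (2 * M))).
Proof.
move=> M o B k0 kL eu eu' hv.
have M0 : 0 < M by exact: fact_gt0.
have [pre [post [spre split]]] := letters_split M kL.
rewrite /B !split !str_cat !mark_cat add0n !size_str spre -/o !size_mkseq.
have env0 x (i : 'I_L.+1) : i != ord0 -> env x v i = nth 0 v i.-1.
  by rewrite /env; case: i => -[].
have hu m x : m <= 2 * M -> x = pos k (hid * (3 * M) + m) ->
    o < x <= o + 3 * M * k.*2.+1.
  move=> hm ->; rewrite /pos mulnDl -/o.
  by have := leq_mul hm (leqnn k.*2.+1); nia.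
have out p : ~~ (o < p <= o + 3 * M * k.*2.+1) ->
    forall i : 'I_L.+1, (env u v i == p) = (env u' v i == p).
  move=> hp i; case: (eqVneq i ord0) => [->|i0]; last by rewrite !env0.
  have hu1 := hu _ _ _ eu; have hu2 := hu _ _ _ eu'.
  by rewrite /env /=; apply/eqP/eqP=> e; move: hp; rewrite -e ?hu1 ?hu2 //; lia.
apply: tp_cat; first last.
  apply: tp_cat.
    have nus x (i : 'I_L.+1) : i != ord0 -> ~~ (o < env x v i <= o + 3 * M * k.*2.+1).
      by move=> i0; rewrite env0.
    rewrite (@mark_seg L M k _ o M) //;
      [|by lia|by rewrite eu /env /= /pos mulnDl|exact: nus].
    rewrite (@mark_seg L M k _ o (2 * M)) //;
      [|by lia|by rewrite eu' /env /= /pos mulnDl|exact: nus].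
    apply: tp_cat; first by rewrite mul2n -addnn tp_pow ?leq_pred.
    apply: tp_cat => //; apply: esym.
    (* The smaller exponent is [M - 1], exactly the least that [tp_pow] admits. *)
    have -> : 3 * M - M.+1 = (3 * M - (2 * M).+1) + M by lia.
    by apply: tp_pow; rewrite -/M; lia.
  rewrite (mark_ext (nu' := env u' v)) // => i p hp; apply: out; lia.
rewrite (mark_ext (nu' := env u' v)) // => i p hp; apply: out.
by move: hp; rewrite size_str spre -/o; lia.
Qed.

(** * Refuting a sublinear learner *)

Lemma exists_fresh (s : seq nat) n : size s <= n -> exists2 i, i <= n & i \notin s.
Proof.
move=> sn; case: (boolP (all (mem s) (iota 0 n.+1))) => [/allP h|/allPn[i]].
  by have := uniq_leq_size (iota_uniq 0 n.+1) h; rewrite size_iota leqNgt ltnS sn.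
by rewrite mem_iota => /= iL ni; exists i.
Qed.

Theorem theorem2 :
  exists (Sigma : finType) (l : nat) (phi : form Sigma),
    is_FO phi /\ unary_formula l phi /\
    forall A : algorithm Sigma,
      ~ (consistent_learner l phi A /\ sublinear_time l phi A).
Proof.
exists letter, 1, next_bit; split=> //; split=> // A [[q [L learn]] sub].
pose M := #|Ty q (letter * {set 'I_L.+1})%type|`!.
have M0 : 0 < M by exact: fact_gt0.
have [f [fsub frun]] := sub (2 * L.+1).
pose c := L.+1 * (3 * M).
have c0 : 0 < c by rewrite /c; lia.
(* As [n = c * (2k + 1)], the bound [3 * c * f n <= n] gives [3 * f n <= 2k + 1], which is below
   [3k] once [k] is at least 2. *)
have [|N fN] := fsub (3 * c); first by lia.
pose k := maxn N 2.
have k0 : 0 < k by rewrite /k; lia.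
pose T := examples L M k.
pose B hid m := str k (letters L M hid m).
pose n := c * k.*2.+1.
have sB hid m : size (B hid m) = n by rewrite size_str size_letters.
have fk : f n < k.
  have : 3 * c * f n <= n by apply: fN; rewrite /n /k; nia.
  by rewrite /n [3 * c]mulnC -mulnA leq_pmul2l // /k; lia.
(* The string with no hidden segment serves as a common reference for all runs. *)
have local hid m : run A (B hid m) T (f n) = run A (B L.+1 M) T (f n).
  apply: run_local; first by rewrite !sB.
  move=> p; apply: near_blank fk _; first by rewrite !size_letters.
  by move=> u /mapP[[u' b] /examplesP[i _ ->] ->]; exists (example_block M i b).
have cons hid m : m = M \/ m = 2 * M -> consistent_ts 1 next_bit (B hid m) T.
  exact: consistent_examples.
have output hid m : m = M \/ m = 2 * M -> exists phi v held,
    [/\ run A (B L.+1 M) T (f n) = Some (phi, v, held), qrank phi <= q, size v <= L,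
        unary_formula (size v) phi & consistent_param phi (B hid m) T v].
  move=> /(cons hid) C; have [t [phi [v [held [r [? [? [? [_ ?]]]]]]]]] := learn _ _ C.
  exists phi, v, held; split=> //; rewrite -(local hid m).
  apply: run_eq r _; rewrite -(sB hid m); apply: frun C _.
  by rewrite size_examples.
have [phi [v [held [r qphi vL uphi _]]]] := output L.+1 M (or_introl erefl).
pose W := 3 * M * k.*2.+1.
(* The output is fixed by now, so the hidden segment can be chosen to avoid it: [W] is the length of
   a segment, and the quotient is the index of the segment containing [p]. *)
have [|hid kL fresh] := @exists_fresh (map (fun p => p.-1 %/ W) v) L.
  by rewrite size_map.
have output' m : m = M \/ m = 2 * M -> consistent_param phi (B hid m) T v.
  by move=> /(output hid)[phi' [v' [h' [+ _ _ _]]]]; rewrite r => -[<- <- _].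
have [vB h1] := output' M (or_introl erefl).
have [_ h2] := output' (2 * M) (or_intror erefl).
have in1 : (pos k (example_block M hid true), true) \in T by apply/examplesP; exists hid.
have in2 : (pos k (example_block M hid false), false) \in T by apply/examplesP; exists hid.
have univ u b : (u, b) \in T -> in_univ (B hid M) u.
  by have [/allP h _] := cons hid M (or_introl erefl) => /h.
(* The truth of [phi] at the positive example for [M] is carried over to the negative example for
   [2 * M]. *)
suff : holds (B hid (2 * M)) phi (pos k (example_block M hid false)) v by move/(h2 _ _ in2).
apply: (tp_holds _ qphi vL uphi (univ _ _ in1) (univ _ _ in2) vB _ (proj2 (h1 _ _ in1) erefl)).
  by rewrite !sB.
apply: tp_letters_shift => // i; rewrite -/M; apply/negP=> hi.
(* Past the end of [v] the default is 0, which lies in no segment. *)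
case: (ltnP i (size v)) => iv; last by rewrite nth_default in hi.
case/mapP: fresh; exists (nth 0 v i); first exact: mem_nth.
rewrite /W; move: hi; set p := nth 0 v i => hi.
have -> : p.-1 = hid * W + (p.-1 - hid * W) by rewrite /W mulnA; lia.
rewrite divnMDl ?divn_small ?addn0 // /W; first by rewrite mulnA; lia.
by rewrite !muln_gt0 M0.
Qed.
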